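(* Let $X\subseteq\mathbb{R}^n$ be a nonempty closed convex set with $0\in X$, $\|\cdot\|$ the Euclidean norm, $D(x\|x')=\frac12\|x-x'\|^2$, and $\max_{x,x'\in X}D(x\|x')\le F^2$. Let $f_1,f_2,\dots$ be i.i.d. random convex differentiable functions $\mathbb{R}^n\to\mathbb{R}$ drawn from a fixed distribution $p$, such that almost surely $\|\nabla f_t(x)\|\le L$ for all $x\in X$ and $\|\nabla f_t(x)-\nabla f_t(x')\|\le H\|x-x'\|$ for all $x,x'$, where $H\ge\frac{L}{4F\sqrt\tau}$. Let $f^*(x)=\mathbb{E}_{f\sim p}[f(x)]$ and let $x^*\in X$ be a minimizer of $f^*$ over $X$. Let $\tau\ge1$, $T\in\mathbb{N}$, and run delayed stochastic gradient descent: $x_1=\dots=x_{\tau+1}=0$, $g_t=\nabla f_t(x_t)$, $x_{t+1}=\operatorname{argmin}_{x\in X}\|x-(x_t-\eta_tg_{t-\tau})\|$ for $t=\tau+1,\dots,T+\tau$, with $\eta_t=\sigma/\sqrt{t-\tau}$ and $\sigma=F/L$. Then the regret $R[X]=\sum_{t=1}^T(f_t(x_t)-f_t(x^* ))$ satisfies $$\mathbb{E}[R[X]]\le\Big[28.3F^2H+\tfrac23FL+\tfrac43F^2H\log T\Big]\tau^2+\tfrac83FL\sqrt T.$$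
   Context: $\log$ denotes the natural logarithm. *)

(* Defs.v *)
From HB Require Import structures.
From mathcomp Require Import all_boot all_order all_algebra.
From mathcomp Require Import all_classical all_reals all_analysis.
Set Implicit Arguments. Unset Strict Implicit. Unset Printing Implicit Defensive.
Import Order.TTheory GRing.Theory Num.Theory.
Import numFieldNormedType.Exports.
Local Open Scope classical_set_scope.
Local Open Scope ring_scope.

Definition enorm (R : realType) (n : nat) (v : 'rV[R]_n) : R :=
  Num.sqrt (\sum_(i < n) v ord0 i ^+ 2).

Definition grad (R : realType) (n : nat) (f : 'rV[R]_n -> R) (x : 'rV[R]_n)
  : 'rV[R]_n := \row_(i < n) ('d f x (delta_mx ord0 i : 'rV[R]_n)).

Definition convex_fun (R : realType) (n : nat) (f : 'rV[R]_n -> R) : Prop :=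
  forall x y (t : R), 0 <= t <= 1 ->
    f ((1 - t) *: x + t *: y) <= (1 - t) * f x + t * f y.

Definition is_proj (R : realType) (n : nat) (X : set 'rV[R]_n) (y z : 'rV[R]_n)
  : Prop := X z /\ forall x, X x -> enorm (z - y) <= enorm (x - y).

Definition mutually_independent d d' (Omega : measurableType d)
  (S : measurableType d') (R : realType) (P : probability Omega R)
  (xi : nat -> Omega -> S) : Prop :=
  forall (s : seq nat) (A : nat -> set S), uniq s ->
    (forall i, i \in s -> measurable (A i)) ->
    P (\big[setI/setT]_(i <- s) (xi i @^-1` A i)) =
    (\prod_(i <- s) P (xi i @^-1` A i))%E.

Definition identically_distributed d d' (Omega : measurableType d)
  (S : measurableType d') (R : realType) (P : probability Omega R)
  (p : probability S R) (xi : nat -> Omega -> S) : Prop :=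
  forall t (A : set S), measurable A -> P (xi t @^-1` A) = p A.

(* Main.v *)
Require Import Defs.
From HB Require Import structures.
From mathcomp Require Import all_boot all_order all_algebra.
From mathcomp Require Import all_classical all_reals all_analysis.
From mathcomp Require Import measurable_realfun.
From mathcomp Require Import ring lra zify.
Import Order.TTheory GRing.Theory Num.Theory.
Import numFieldNormedType.Exports.
Local Open Scope classical_set_scope.
Local Open Scope ring_scope.

(** Split [f_t(x_t) - f_t(x^* )] at [x_(t+tau)].

    Since [x_(t+tau)] only depends on [f_1, ..., f_(t-1)], it is independent of
    [f_t], so the expectation of [f_t(x_t) - f_t(x_(t+tau))] is that of
    [f^*(x_t) - f^*(x_(t+tau))]; summed over [t] this telescopes to [tau]
    terms, each of size [O(F L)].

    For the rest, convexity and the Lipschitz gradient give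
    [f_t(x_(t+tau)) - f_t(x^* ) <= <g_t, x_(t+tau) - x^*> + H |x_(t+tau) - x_t|^2].
    In the inner product the delay has disappeared: [x_(t+tau)] is updated along
    [g_t], so the usual descent estimate bounds the sum by [2 F L sqrt T].  The
    squared drifts are at most [2 F^2] for [t <= tau] and [(F tau)^2 / (t - tau)]
    afterwards, a harmonic sum.  As [F L tau <= 4 F^2 H tau^2], everything fits
    into the constant [28.3 F^2 H tau^2].

    The iterates need not be measurable, because of the exceptional null set of
    [p].  Instead, outside a null set each iterate is approximated uniformly by a
    map with finitely many values whose fibres are cylinders
    [forall i < t, xi_i \in B_i], and independence is only used for cylinders. *)

Set Implicit Arguments.
Unset Strict Implicit.
Unset Printing Implicit Defensive.

(** * Euclidean geometry and delayed descent *)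

Section Euclidean.
Context {R : realType} {n : nat}.
Implicit Types (u v w x y : 'rV[R]_n) (f : 'rV[R]_n -> R).

Definition dot u v : R := \sum_(i < n) u ord0 i * v ord0 i.

Lemma dotC u v : dot u v = dot v u.
Proof. by apply: eq_bigr => i _; rewrite mulrC. Qed.

Lemma dotDr u v w : dot u (v + w) = dot u v + dot u w.
Proof. by rewrite -big_split /=; apply: eq_bigr => i _; rewrite mxE mulrDr. Qed.

Lemma dotZr a u v : dot u (a *: v) = a * dot u v.
Proof. by rewrite mulr_sumr; apply: eq_bigr => i _; rewrite mxE mulrCA. Qed.

Lemma dotNr u v : dot u (- v) = - dot u v.
Proof. by rewrite -scaleN1r dotZr mulN1r. Qed.

Lemma dotBr u v w : dot u (v - w) = dot u v - dot u w.
Proof. by rewrite dotDr dotNr. Qed.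

Lemma dotDl u v w : dot (u + v) w = dot u w + dot v w.
Proof. by rewrite dotC dotDr !(dotC w). Qed.

Lemma dotZl a u v : dot (a *: u) v = a * dot u v.
Proof. by rewrite dotC dotZr dotC. Qed.

Lemma dotBl u v w : dot (u - v) w = dot u w - dot v w.
Proof. by rewrite dotC dotBr !(dotC w). Qed.

Lemma enorm_ge0 u : 0 <= enorm u.
Proof. exact: sqrtr_ge0. Qed.

Lemma sqr_enorm u : enorm u ^+ 2 = dot u u.
Proof.
rewrite sqr_sqrtr; first by apply: eq_bigr => i _; rewrite expr2.
by apply: sumr_ge0 => i _; rewrite sqr_ge0.
Qed.

Lemma enormZ a u : enorm (a *: u) = `|a| * enorm u.
Proof.
apply/eqP; rewrite -(eqrXn2 (ltn0Sn 1)) ?mulr_ge0 ?enorm_ge0 //.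
by rewrite exprMn !sqr_enorm dotZl dotZr real_normK ?num_real // mulrA expr2.
Qed.

Lemma enorm0 : enorm (0 : 'rV[R]_n) = 0.
Proof. by rewrite -(scale0r 0) enormZ normr0 mul0r. Qed.

Lemma enormN u : enorm (- u) = enorm u.
Proof. by rewrite -scaleN1r enormZ normrN normr1 mul1r. Qed.

Lemma enormB u v : enorm (u - v) = enorm (v - u).
Proof. by rewrite -enormN opprB. Qed.

Lemma enorm_coord u i : `|u ord0 i| <= enorm u.
Proof.
rewrite -sqrtr_sqr ler_sqrt; last by apply: sumr_ge0 => j _; rewrite sqr_ge0.
by rewrite (bigD1 i) //= lerDl sumr_ge0 // => j _; rewrite sqr_ge0.
Qed.

Lemma dot_eq0 u v : enorm u = 0 -> dot u v = 0.
Proof.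
move=> u0; rewrite /dot big1 // => i _; have := enorm_coord u i.
by rewrite u0 normr_le0 => /eqP ->; rewrite mul0r.
Qed.

Lemma dot_le u v : dot u v <= enorm u * enorm v.
Proof.
have [u0|u0] := eqVneq (enorm u) 0; first by rewrite dot_eq0 // u0 mul0r.
have [v0|v0] := eqVneq (enorm v) 0; first by rewrite dotC dot_eq0 // v0 mulr0.
have uv_gt0 : 0 < enorm u * enorm v by rewrite mulr_gt0 // lt_neqAle eq_sym ?u0 ?v0 enorm_ge0.
rewrite -(ler_pM2l uv_gt0).
have := sqr_ge0 (enorm (enorm v *: u - enorm u *: v)).
rewrite !sqr_enorm dotBl !dotBr !dotZl !dotZr (dotC v u) -!sqr_enorm; lra.
Qed.

Lemma enormD u v : enorm (u + v) <= enorm u + enorm v.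
Proof.
rewrite -(@ler_pXn2r _ 2) ?nnegrE ?addr_ge0 ?enorm_ge0 //.
rewrite sqr_enorm dotDl !dotDr (dotC v u) -!sqr_enorm.
by have := dot_le u v; lra.
Qed.

Lemma enorm_le_sum u : enorm u <= \sum_(i < n) `|u ord0 i|.
Proof.
rewrite -(@ler_pXn2r _ 2) ?nnegrE ?enorm_ge0 ?sumr_ge0 //.
rewrite sqr_enorm expr2 mulr_suml; apply: ler_sum => i _.
rewrite -expr2 -real_normK ?num_real // expr2 ler_wpM2l //.
by rewrite (bigD1 i) //= lerDl sumr_ge0.
Qed.

Lemma dot_grad f x v : differentiable f x -> 'd f x v = dot (grad f x) v.
Proof.
move=> df; rewrite {1}(row_sum_delta v) linear_sum; apply: eq_bigr => i _.
by rewrite linearZ mxE mulrC.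
Qed.

(** For [h] in []0, 1]], convexity bounds the difference quotient at [x] along [y - x] by
    [f y - f x]; let [h] tend to 0 from the right. *)
Lemma convex_fun_grad f x y : convex_fun f -> differentiable f x ->
  f x + dot (grad f x) (y - x) <= f y.
Proof.
move=> cf df; rewrite -dot_grad // -deriveE // -lerBrDl.
have dv : derivable f x (y - x) by exact: diff_derivable.
have dv' := cvg_dnbhs_at_right dv.
apply: (cvgr_to_le dv'); near=> h.
have h0 : 0 < h by [].
have h1 : h <= 1 by near: h; apply: nbhs_right_le.
rewrite /= -[_ *: _]/(h^-1 * _) mulrC ler_pdivrMr //.
have := cf x y h.
rewrite (ltW h0) h1 => /(_ isT).
have -> : (1 - h) *: x + h *: y = h *: (y - x) + x.
  by apply/rowP => i; rewrite !mxE; ring.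
lra.
Unshelve. all: by end_near. Qed.

Lemma is_proj_var (X : set 'rV[R]_n) p z u : convex_set X -> is_proj X p z -> X u ->
  dot (p - z) (u - z) <= 0.
Proof.
move=> cX [Xz minz] Xu; rewrite leNgt; apply/negP => d0.
have e_gt0 : 0 < enorm (u - z) ^+ 2 + dot (p - z) (u - z).
  by rewrite ltr_wpDl ?sqr_ge0.
(* If the inner product [d] were positive, moving from [z] towards [u] by the fraction [h] would get
   closer to [p]: this denominator gives both [h <= 1] and [h * |u - z|^2 < d], whereas minimality
   of [z] requires [2 * d <= h * |u - z|^2]. *)
set e := _ + _ in e_gt0; pose h := dot (p - z) (u - z) / e.
have h0 : 0 < h by rewrite divr_gt0.
have h1 : h <= 1 by rewrite ler_pdivrMr // mul1r /e lerDr sqr_ge0.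
have Xh : X (h *: u + (1 - h) *: z).
  have h01 : (0 <= h <= 1) by rewrite (ltW h0).
  have := cX u z (Itv01 (ltW h0) h1).
  by rewrite !inE => /(_ Xu Xz).
have := minz _ Xh.
rewrite -(@ler_pXn2r _ 2) ?nnegrE ?enorm_ge0 //.
have -> : h *: u + (1 - h) *: z - p = h *: (u - z) - (p - z).
  by apply/rowP => i; rewrite !mxE; ring.
rewrite (enormB z p) {Xh h1}; subst e.
move: (u - z) (p - z) @h d0 e_gt0 h0 => v q h d0 e_gt0 h0.
rewrite 2!sqr_enorm dotBl !dotBr !dotZl !dotZr (dotC v q) => H.
have {H} : 2 * dot q v <= h * enorm v ^+ 2.
  by rewrite -(ler_pM2l h0) sqr_enorm; lra.
rewrite /h mulrAC ler_pdivlMr // => H.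
have : 2 * (enorm v ^+ 2 + dot q v) <= enorm v ^+ 2 by rewrite -(ler_pM2l d0); lra.
by have := sqr_ge0 (enorm v); lra.
Qed.

(** Adding the variational inequalities at [z] and [w] yields [|z - w|^2 <= <p - q, z - w>];
    Cauchy-Schwarz concludes. *)
Lemma is_proj_nonexp (X : set 'rV[R]_n) p q z w : convex_set X -> is_proj X p z -> is_proj X q w ->
  enorm (z - w) <= enorm (p - q).
Proof.
move=> cX pz qw.
have h1 := is_proj_var cX pz qw.1; have h2 := is_proj_var cX qw pz.1.
have [->|zw] := eqVneq (enorm (z - w)) 0; first exact: enorm_ge0.
have zw_gt0 : 0 < enorm (z - w) by rewrite lt_neqAle eq_sym zw enorm_ge0.
rewrite -(ler_pM2r zw_gt0) (le_trans _ (dot_le _ _)) // -expr2 sqr_enorm.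
rewrite -subr_ge0 -dotBl.
have -> : p - q - (z - w) = (p - z) - (q - w) by apply/rowP => i; rewrite !mxE; ring.
by rewrite dotBl; move: h1; rewrite -(opprB z w) dotNr; lra.
Qed.

Lemma is_proj_id (X : set 'rV[R]_n) z : X z -> is_proj X z z.
Proof. by move=> Xz; split=> // x _; rewrite subrr enorm0 enorm_ge0. Qed.

(** As [z] is its own projection, nonexpansiveness bounds [|w - z|] by [|y - eta g - z|]; expand the
    square and divide by [2 eta]. *)
Lemma sgd_step (X : set 'rV[R]_n) (eta : R) y g w z : convex_set X -> 0 < eta ->
  is_proj X (y - eta *: g) w -> X z ->
  dot g (y - z) <=
    (enorm (y - z) ^+ 2 - enorm (w - z) ^+ 2) / (2 * eta) + eta / 2 * enorm g ^+ 2.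
Proof.
move=> cX eta0 pw Xz.
have := is_proj_nonexp cX pw (is_proj_id Xz).
rewrite -(@ler_pXn2r _ 2) ?nnegrE ?enorm_ge0 // addrAC; move: (y - z) => v.
rewrite (sqr_enorm (v - eta *: g)) dotBl !dotBr !dotZl !dotZr (dotC v g) -!sqr_enorm.
move=> H.
have e0 : 0 < 2 * eta by rewrite mulr_gt0.
rewrite -(ler_pM2l e0) mulrDr mulrCA mulfV ?gt_eqF // mulr1; lra.
Qed.

End Euclidean.

(** * Sums of inverse square roots and of inverses *)

Section Sums.
Context {R : realType}.

Lemma sum_inv_sqrt (T : nat) :
  \sum_(1 <= t < T.+1) (Num.sqrt (t%:R : R))^-1 <= 2 * Num.sqrt T%:R.
Proof.
elim: T => [|T IH]; first by rewrite big_geq // sqrtr0 mulr0.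
rewrite big_nat_recr //=; apply: le_trans (lerD IH (lexx _)) _.
have sT : 0 < Num.sqrt (T.+1%:R : R) by rewrite sqrtr_gt0.
rewrite -(ler_pM2r sT) mulrDl mulVf ?gt_eqF // -[leRHS]mulrA -expr2 sqr_sqrtr //.
(* After multiplication by [sqrt (T+1)], the induction step is exactly the nonnegativity of this
   square. *)
have := sqr_ge0 (Num.sqrt (T.+1%:R : R) - Num.sqrt T%:R).
rewrite sqrrB !sqr_sqrtr // -natr1; lra.
Qed.

Lemma sum_inv_le_ln (T : nat) : \sum_(1 <= t < T.+1) (t%:R : R)^-1 <= 1 + ln T%:R.
Proof.
(* The empty sum is covered because [ln 0] is 0. The inductive step is
   [1/m <= ln m - ln (m-1) = - ln (1 - 1/m)], an instance of [ln (1 + x) <= x]. *)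
elim: T => [|[|T] IH]; first by rewrite big_geq // ln0 // addr0.
  by rewrite big_nat1 ln1 addr0 invr1.
rewrite big_nat_recr //=; apply: le_trans (lerD IH (lexx _)) _.
rewrite -addrA lerD2l -lerBrDl; set m : R := T.+2%:R.
have m0 : 0 < m by rewrite ltr0n.
have m1 : 0 < T.+1%:R :> R by rewrite ltr0n.
have -> : ln m - ln T.+1%:R = - ln (1 + - m^-1).
  rewrite -opprB -ln_div ?posrE //; congr (- ln _).
  have -> : T.+1%:R = m - 1 by rewrite /m -[in RHS]natr1 addrK.
  by rewrite mulrBl mulfV ?gt_eqF // mul1r.
by rewrite lerNr le_ln1Dx // ltrN2 invf_lt1 // ltr1n.
Qed.

End Sums.

(** The arithmetic of [delayed_regret_le]: [u], [v], [w] are the values of [h t] at [y t],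
    [y (t + tau)] and [z]. The first two premises are tangent inequalities; the third compares the
    gradients at [y (t + tau)] and [y t]. *)
Lemma linear_gap_le (R : realDomainType) (a b c e u v w : R) :
  u - a <= w -> v - b <= u -> b - c <= e -> v - w <= c + a + e.
Proof. lra. Qed.

(** * Pathwise regret of delayed descent, for a fixed sequence of functions *)

Section DelayedDescent.
Context {R : realType} {n : nat}.
Variables (X : set 'rV[R]_n) (F L H : R) (tau T : nat).
Variables (h : nat -> 'rV[R]_n -> R) (y : nat -> 'rV[R]_n).
Hypotheses (cX : convex_set X) (F0 : 0 < F) (L0 : 0 < L) (H0 : 0 <= H).
Hypothesis diamX : forall u v, X u -> X v -> enorm (u - v) ^+ 2 / 2 <= F ^+ 2.
Hypothesis hcvx : forall t, convex_fun (h t).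
Hypothesis hdiff : forall t u, differentiable (h t) u.
Hypothesis hgrad : forall t u, X u -> enorm (grad (h t) u) <= L.
Hypothesis hsmooth : forall t u v,
  enorm (grad (h t) u - grad (h t) v) <= H * enorm (u - v).
Hypothesis Xy : forall t, (1 <= t <= (T + tau).+1)%N -> X (y t).
Hypothesis stepy : forall t, (tau.+1 <= t <= T + tau)%N ->
  is_proj X (y t - (F / L / Num.sqrt (t - tau)%:R) *: grad (h (t - tau)) (y (t - tau)%N))
    (y t.+1).

Let rate_gt0 t : (0 < t)%N -> 0 < F / L / Num.sqrt (t%:R : R).
Proof. by move=> t0; rewrite !divr_gt0 // sqrtr_gt0 ltr0n. Qed.

(** [y t] is its own projection, so the projected step is no longer than the step size times [L]. *)
Lemma step_length t : (tau.+1 <= t <= T + tau)%N ->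
  enorm (y t.+1 - y t) <= F / Num.sqrt (t - tau)%:R.
Proof.
move=> tT; have Xt : X (y t) by apply: Xy; lia.
have := is_proj_nonexp cX (stepy tT) (is_proj_id Xt).
rewrite addrAC subrr sub0r enormN enormZ => /le_trans; apply.
have r0 : 0 < F / L / Num.sqrt (t - tau)%:R by apply: rate_gt0; lia.
rewrite gtr0_norm //.
have -> : F / Num.sqrt (t - tau)%:R = F / L / Num.sqrt (t - tau)%:R * L.
  by rewrite mulrAC divfK // gt_eqF.
by rewrite ler_pM2l //; apply: hgrad; apply: Xy; lia.
Qed.

(** Triangle inequality over [k] steps; the step-length bounds decrease, so the first one serves for
    all. *)
Lemma drift_le t k : (tau.+1 <= t)%N -> (t + k <= (T + tau).+1)%N ->
  enorm (y (t + k) - y t) <= k%:R * (F / Num.sqrt (t - tau)%:R).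
Proof.
move=> tT; elim: k => [|k IH] tk; first by rewrite addn0 subrr enorm0 mul0r.
have -> : y (t + k.+1) - y t = (y (t + k).+1 - y (t + k)) + (y (t + k) - y t).
  by rewrite addnS; apply/rowP => i; rewrite !mxE; ring.
rewrite -natr1 mulrDl mul1r addrC; apply: le_trans (enormD _ _) _.
rewrite lerD //; first by apply: IH; lia.
apply: le_trans (step_length _) _; first lia.
rewrite ler_pM2l // lef_pV2 ?posrE ?sqrtr_gt0 ?ltr0n; try lia.
by rewrite ler_sqrt ?ler_nat //; lia.
Qed.

Let drift2 t := if (t <= tau)%N then 2 * F ^+ 2 else (F * tau%:R) ^+ 2 / (t - tau)%:R.

Lemma sqr_drift_le t : (1 <= t <= T)%N -> enorm (y (t + tau) - y t) ^+ 2 <= drift2 t.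
Proof.
move=> tT; rewrite /drift2; case: ifPn => [ttau|].
  rewrite -ler_pdivrMl // mulrC; apply: diamX; apply: Xy; lia.
rewrite -ltnNge => ttau.
have st : 0 < ((t - tau)%:R : R) by rewrite ltr0n; lia.
rewrite -(sqr_sqrtr (ltW st)) -expr_div_n ler_pXn2r ?nnegrE ?enorm_ge0 //; last first.
  by rewrite !mulr_ge0 ?invr_ge0 ?sqrtr_ge0 // ltW.
by rewrite (mulrC F) -mulrA; apply: drift_le; lia.
Qed.

Lemma sum_drift2 : \sum_(1 <= t < T.+1) drift2 t <=
  2 * F ^+ 2 * tau%:R + (F * tau%:R) ^+ 2 * (1 + ln T%:R).
Proof.
have F2 : 0 <= F ^+ 2 by exact: sqr_ge0.
have init m : (m <= tau)%N -> \sum_(1 <= t < m.+1) drift2 t <= 2 * F ^+ 2 * tau%:R.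
  move=> mtau; under eq_big_nat => t tm.
    rewrite /drift2 ifT; last lia.
    over.
  by rewrite sumr_const_nat subSS subn0 -[leLHS]mulr_natr ler_wpM2l ?ler_nat // mulr_ge0.
have ln0T : 0 <= 1 + ln (T%:R : R).
  case: T => [|m]; first by rewrite ln0 // addr0.
  by rewrite addr_ge0 // ln_ge0 // ler1n.
have [Ttau|tauT] := leqP T tau.
  by rewrite -[leLHS]addr0 lerD ?init // mulr_ge0 ?sqr_ge0.
rewrite (@big_cat_nat _ _ _ tau.+1) //=; last lia.
rewrite lerD ?init //.
(* Reindexing by [t - tau] leaves a harmonic sum up to [T - tau], and [ln (T - tau) <= ln T]. *)
rewrite -[tau.+1]add1n big_addn subSn; last lia.
under eq_big_nat => t tm.
  rewrite /drift2 addnK ifF; last by apply/negbTE; rewrite -ltnNge; lia.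
  over.
rewrite -mulr_sumr ler_wpM2l ?sqr_ge0 //; apply: le_trans (sum_inv_le_ln _) _.
by rewrite lerD2l ler_ln ?posrE ?ltr0n ?ler_nat; lia.
Qed.

Lemma sum_sgd z : X z -> \sum_(1 <= t < T.+1) dot (grad (h t) (y t)) (y (t + tau) - z)
   <= 2 * F * L * Num.sqrt T%:R.
Proof.
move=> Xz; pose D t := enorm (y t - z) ^+ 2 / 2.
have Dle t : (1 <= t <= (T + tau).+1)%N -> D t <= F ^+ 2.
  by move=> tT; apply: diamX => //; exact: Xy.
(* Summation by parts as an invariant. The weight [L / F * sqrt m] is the inverse of the [m]-th step
   size; since [D <= F^2], raising it to that of [m+1] only enlarges the slack term [F^2 - D], into
   which the next descent inequality then telescopes. *)
suff HS m : (m <= T)%N ->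
    \sum_(1 <= t < m.+1) dot (grad (h t) (y t)) (y (t + tau) - z) <=
    L / F * Num.sqrt m%:R * (F ^+ 2 - D (m + tau).+1)
      + F * L / 2 * \sum_(1 <= t < m.+1) (Num.sqrt (t%:R : R))^-1.
  apply: le_trans (HS _ (leqnn T)) _.
  have := sum_inv_sqrt (R := R) T.
  rewrite -(ler_pM2l (_ : 0 < F * L / 2)) ?divr_gt0 ?mulr_gt0 // => H1.
  have D0 : 0 <= D (T + tau).+1 by rewrite divr_ge0 ?sqr_ge0.
  have c0 : 0 <= L / F * Num.sqrt T%:R by rewrite mulr_ge0 ?sqrtr_ge0 ?divr_ge0 ?ltW.
  have H2 : L / F * Num.sqrt T%:R * (F ^+ 2 - D (T + tau).+1) <= F * L * Num.sqrt T%:R.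
    have -> : F * L * Num.sqrt T%:R = L / F * Num.sqrt T%:R * F ^+ 2.
      by field; rewrite gt_eqF.
    by rewrite ler_wpM2l //; lra.
  lra.
elim: m => [_|m IH mT]; first by rewrite !big_geq // sqrtr0 mulr0 mul0r mulr0 addr0.
rewrite !(@big_nat_recr _ _ _ m.+1) //= mulrDr.
have s0 : 0 < Num.sqrt (m.+1%:R : R) by rewrite sqrtr_gt0.
have eta0 : 0 < F / L / Num.sqrt (m.+1%:R : R) by exact: rate_gt0.
have : is_proj X (y (m.+1 + tau)%N - F / L / Num.sqrt m.+1%:R *: grad (h m.+1) (y m.+1))
  (y (m.+1 + tau).+1).
  by have := @stepy (m.+1 + tau)%N; rewrite addnK; apply; lia.
move=> /(sgd_step cX eta0) /(_ Xz) Hs.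
have Hg : enorm (grad (h m.+1) (y m.+1)) ^+ 2 <= L ^+ 2.
  rewrite ler_pXn2r ?nnegrE ?enorm_ge0 ?(ltW L0) //.
  by apply: hgrad; apply: Xy; lia.
set e := F / L / _ in eta0 Hs.
have {}Hg : e / 2 * enorm (grad (h m.+1) (y m.+1)) ^+ 2 <= F * L / 2 * (Num.sqrt m.+1%:R)^-1.
  have -> : F * L / 2 * (Num.sqrt m.+1%:R)^-1 = e / 2 * L ^+ 2.
    by rewrite /e; field; rewrite !gt_eqF.
  by rewrite ler_wpM2l // divr_ge0 // ltW.
have He a b : (a - b) / (2 * e) = L / F * Num.sqrt m.+1%:R * (a / 2 - b / 2).
  by rewrite /e; field; rewrite !gt_eqF.
rewrite He -/(D (m.+1 + tau)%N) -/(D (m.+1 + tau).+1) in Hs.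
have Dm : D (m.+1 + tau)%N <= F ^+ 2 by apply: Dle; lia.
have {}IH := IH (ltnW mT); rewrite -addSn in IH.
have HD : L / F * Num.sqrt m%:R * (F ^+ 2 - D (m.+1 + tau)%N) <=
          L / F * Num.sqrt m.+1%:R * (F ^+ 2 - D (m.+1 + tau)%N).
  by rewrite ler_wpM2r ?subr_ge0 // ler_wpM2l ?ler_sqrt ?ler_nat ?divr_ge0 ?ltW.
lra.
Qed.

Lemma delayed_regret_le z : X z ->
  \sum_(1 <= t < T.+1) (h t (y (t + tau)%N) - h t z) <=
    2 * F * L * Num.sqrt T%:R
    + H * (2 * F ^+ 2 * tau%:R + (F * tau%:R) ^+ 2 * (1 + ln T%:R)).
Proof.
move=> Xz; apply: le_trans (lerD (sum_sgd Xz) (ler_wpM2l H0 sum_drift2)).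
rewrite mulr_sumr -big_split /=; apply: ler_sum_nat => t tT.
have Hd := sqr_drift_le tT.
have {}Hd := ler_wpM2l H0 Hd.
have h1 := convex_fun_grad z (hcvx t) (hdiff t (y t)).
have h2 := convex_fun_grad (y t) (hcvx t) (hdiff t (y (t + tau)%N)).
have h3 := dot_le (grad (h t) (y (t + tau)%N) - grad (h t) (y t)) (y (t + tau)%N - y t).
have h4 := ler_wpM2r (enorm_ge0 (y (t + tau)%N - y t)) (hsmooth t (y (t + tau)%N) (y t)).
rewrite -mulrA -expr2 in h4; rewrite dotBl in h3.
rewrite -(opprB (y (t + tau)%N) (y t)) dotNr in h2.
rewrite -(opprB (y t) z) dotNr in h1.
rewrite -(subrKA (y t) (y (t + tau)%N) (- z)) dotDr.
exact: linear_gap_le h1 h2 (le_trans h3 (le_trans h4 Hd)).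
Qed.

End DelayedDescent.

(** * Cylinder events and expectations *)

Section IntegralFacts.
Local Open Scope ereal_scope.
Context {d : measure_display} {T : measurableType d} {R : realType}.
Variable mu : {measure set T -> \bar R}.

(* No measurability: the library's integral is a supremum over simple functions. *)
Lemma le_integral_everywhere (f g : T -> \bar R) : (forall w, f w <= g w) ->
  \int[mu]_w f w <= \int[mu]_w g w.
Proof.
move=> fg; rewrite /integral /=; apply: leeB; apply: le_ereal_sup => _ [h /= hle <-];
  exists h => //= w;
  apply: (le_trans (hle w)); rewrite !patch_setT.
- by rewrite !funeposE ge_max !le_max fg lexx /= orbT.
- by rewrite !funenegE ge_max !le_max leeN2 fg lexx /= orbT.
Qed.

(** Only [g] is altered on the null set: setting it to [+oo] there keeps its integral and makes it
    dominate [f] everywhere, so [f] may be non-measurable. *)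
Lemma le_integral_negligible (f g : T -> R) (N : set T) :
  measurable N -> mu N = 0 -> measurable_fun setT g ->
  (forall w, ~ N w -> (f w <= g w)%R) ->
  \int[mu]_w (f w)%:E <= \int[mu]_w (g w)%:E.
Proof.
move=> mN N0 mg fg.
pose g' w := if w \in N then +oo else (g w)%:E.
have -> : \int[mu]_w (g w)%:E = \int[mu]_w g' w.
  apply: ae_eq_integral => //.
  - exact/measurable_EFinP.
  - apply: measurable_fun_ifT => //; last exact/measurable_EFinP.
    by apply: (@measurable_fun_bool _ _ _ _ true); rewrite setTI preimage_mem_true.
  - exists N; split => // w; apply: contra_notP => Nw _.
    by rewrite /g' memNset.
apply: le_integral_everywhere => w; rewrite /g'; case: ifPn => [_|]; first exact: leey.
by rewrite notin_setE => /fg; rewrite lee_fin.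
Qed.

End IntegralFacts.

Section Independence.
Local Open Scope ereal_scope.
Context {d d' : measure_display} {Omega : measurableType d} {S : measurableType d'}.
Context {R : realType} (P : probability Omega R) (p : probability S R).
Variable xi : nat -> Omega -> S.
Hypothesis mxi : forall t, measurable_fun setT (xi t).
Hypothesis indep : mutually_independent P xi.
Hypothesis idist : identically_distributed P p xi.

(* Rectangles suffice for independence here, so no pi-lambda argument is needed. *)
Definition cylinder (t : nat) (A : set Omega) : Prop :=
  exists2 B : nat -> set S, (forall i, measurable (B i)) &
    A = [set w | forall i, (i < t)%N -> B i (xi i w)].

Lemma measurable_xi i B : measurable B -> measurable (xi i @^-1` B).
Proof. by move=> mB; rewrite -[X in measurable X]setTI; exact: mxi. Qed.

Lemma cylinder_setT t : cylinder t setT.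
Proof. by exists (fun=> setT) => //; apply/seteqP; split. Qed.

Lemma cylinder_preimage t i B : (i < t)%N -> measurable B -> cylinder t (xi i @^-1` B).
Proof.
move=> it mB; exists (fun j => if j == i then B else setT) => [j|]; first by case: ifP.
apply/seteqP; split => w /= => [Bw j _|/(_ i it)]; last by rewrite eqxx.
by case: eqP => // ->.
Qed.

Lemma cylinderI t A B : cylinder t A -> cylinder t B -> cylinder t (A `&` B).
Proof.
move=> [C mC ->] [D mD ->]; exists (fun i => C i `&` D i) => [i|].
  exact: measurableI.
apply/seteqP; split => w /= => [[cw dw] i it|cdw].
  by split; [exact: cw|exact: dw].
by split => i /cdw[].
Qed.

Lemma cylinderE t (B : nat -> set S) :
  [set w | forall i, (i < t)%N -> B i (xi i w)] =
  \big[setI/setT]_(i <- iota 0 t) (xi i @^-1` B i).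
Proof.
rewrite -bigcap_seq; apply/seteqP; split => w /= Bw i.
  by rewrite /= mem_iota add0n => /Bw.
by move=> it; apply: Bw; rewrite /= mem_iota add0n.
Qed.

Lemma cylinder_measurable t A : cylinder t A -> measurable A.
Proof.
move=> [B mB ->]; rewrite cylinderE; apply: bigsetI_measurable => i _.
exact: measurable_xi.
Qed.

Lemma cylinder_indep t A C : cylinder t A -> measurable C ->
  P (xi t @^-1` C `&` A) = P A * p C.
Proof.
move=> [B mB ->] mC; rewrite cylinderE.
(* [B'] inserts [C] at index [t]. Independence over [t :: iota 0 t] splits the probability into a
   product, and independence over [iota 0 t] folds the tail back into [P A]. *)
pose B' i := if i == t then C else B i.
have mB' i : measurable (B' i) by rewrite /B'; case: ifP.
have B'E i : i \in iota 0 t -> B' i = B i.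
  by rewrite mem_iota add0n /B' => /ltn_eqF ->.
have E : \big[setI/setT]_(i <- iota 0 t) (xi i @^-1` B i) =
         \big[setI/setT]_(i <- iota 0 t) (xi i @^-1` B' i).
  by apply: eq_big_seq => i /B'E ->.
have := @indep (t :: iota 0 t) B'.
have ut : uniq (t :: iota 0 t) by rewrite /= iota_uniq mem_iota add0n ltnn.
move=> /(_ ut (fun i _ => mB' i)); rewrite !big_cons -indep ?iota_uniq //.
by rewrite -E /B' eqxx idist // muleC.
Qed.

(** By [cylinder_indep], the law of [xi t] under [P] restricted to [A] is [p] scaled by [P A]; the
    formula is a change of variables. *)
Lemma ge0_integral_cylinder t A (k : S -> \bar R) : cylinder t A ->
  measurable_fun setT k -> (forall s, 0 <= k s) ->
  \int[P]_(w in A) k (xi t w) = P A * \int[p]_s k s.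
Proof.
move=> cA mk k0; have mA := cylinder_measurable cA.
have mkxi : measurable_fun setT (k \o xi t) by exact: measurableT_comp.
pose PA := mrestr P mA.
have -> : \int[P]_(w in A) k (xi t w) = \int[PA]_(w in A) k (xi t w).
  by apply: eq_measure_integral => B mB BA; rewrite /PA /= /mrestr setIidl.
have -> : \int[PA]_(w in A) k (xi t w) = \int[PA]_w k (xi t w).
  rewrite (@ge0_negligible_integral _ _ _ PA setT (~` A)) ?setTD ?setCK //.
  - exact: measurableC.
  - by rewrite /PA /= /mrestr setICl measure0.
have <- := @ge0_integral_pushforward _ _ _ _ _ (xi t) (mxi t) PA setT k measurableT mk
  (fun _ _ => k0 _).
have PA0 : (0 <= fine (P A))%R by rewrite fine_ge0.
pose pA := mscale (NngNum PA0) p.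
have -> : \int[pushforward PA (xi t)]_y k y = \int[pA]_y k y.
  apply: eq_measure_integral => B mB _.
  rewrite /pA /= /mscale /= /pushforward /mrestr (cylinder_indep cA mB).
  by rewrite fineK // fin_num_measure.
by rewrite ge0_integral_mscale //= fineK // fin_num_measure.
Qed.

(** Integrability is bundled with the value, so means add and change sign without side
    conditions. *)
Definition has_mean (Y : Omega -> R) (m : R) : Prop :=
  P.-integrable setT (EFin \o Y) /\ \int[P]_w (Y w)%:E = m%:E.

Lemma has_meanD Y1 m1 Y2 m2 : has_mean Y1 m1 -> has_mean Y2 m2 ->
  has_mean (fun w => Y1 w + Y2 w)%R (m1 + m2)%R.
Proof.
move=> [i1 e1] [i2 e2]; split.
  rewrite (_ : _ \o _ = (EFin \o Y1) \+ (EFin \o Y2)); last by apply/funext.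
  exact: integrableD.
by rewrite EFinD -e1 -e2 -integralD.
Qed.

Lemma has_meanN Y m : has_mean Y m -> has_mean (fun w => - Y w)%R (- m)%R.
Proof.
move=> [i1 e1]; split.
  by rewrite (_ : _ \o _ = \- (EFin \o Y)); [exact: integrableN|apply/funext].
by rewrite EFinN -e1 -integralN //; last exact: integrable_add_def.
Qed.

Lemma has_mean_cst m : has_mean (cst m) m.
Proof.
split; first exact: finite_measure_integrable_cst.
by rewrite -[LHS]/(\int[P]_w cst m%:E w) integral_cst //= probability_setT mule1.
Qed.

Lemma has_mean_sum (I : Type) (r : seq I) (Y : I -> Omega -> R) m :
  (forall i, has_mean (Y i) (m i)) ->
  has_mean (fun w => \sum_(i <- r) Y i w)%R (\sum_(i <- r) m i)%R.
Proof.
move=> H; elim: r => [|i r IH].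
  rewrite big_nil (_ : (fun _ => _) = cst 0%R); first exact: has_mean_cst.
  by apply/funext => w; rewrite big_nil.
rewrite big_cons (_ : (fun _ => _) = (fun w => Y i w + \sum_(j <- r) Y j w)%R).
  exact: has_meanD.
by apply/funext => w; rewrite big_cons.
Qed.

(** The nonnegative case applied to [|k|] gives integrability, and applied to the positive and
    negative parts of [k] gives the value. *)
Lemma has_mean_cylinder t A (k : S -> R) : cylinder t A ->
  p.-integrable setT (EFin \o k) ->
  has_mean (fun w => \1_A w * k (xi t w))%R (fine (P A) * \int[p]_s k s)%R.
Proof.
move=> cA ik; have mA := cylinder_measurable cA.
have mk : measurable_fun setT (EFin \o k) by exact: measurable_int ik.
have E : EFin \o (fun w => \1_A w * k (xi t w))%R = (fun w => (k (xi t w))%:E) \_ A.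
  by rewrite epatch_indic; apply/funext => w /=; rewrite EFinM muleC.
have PAf : P A \is a fin_num by exact: fin_num_measure.
split.
  rewrite E; apply/(integrable_mkcond _ mA)/integrableP; split.
    by apply: measurable_funTS; exact: (measurableT_comp mk (mxi t)).
  rewrite (ge0_integral_cylinder (k := fun s => `|(k s)%:E|)) //; last first.
    exact: (measurableT_comp (@abse_measurable _ setT) mk).
  by move/integrableP: ik => [_ ik]; rewrite lte_mul_pinfty.
transitivity (\int[P]_w ((fun w => (k (xi t w))%:E) \_ A) w); first by rewrite -E.
rewrite -integral_mkcond integralE.
under eq_integral do rewrite funeposE -[_%:E]/((EFin \o k) (xi t _)) -funeposE.
under [X in _ - X]eq_integral do rewrite funenegE -[_%:E]/((EFin \o k) (xi t _)) -funenegE.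
rewrite (ge0_integral_cylinder (k := (EFin \o k)^\+)) //; last exact: measurable_funepos.
rewrite (ge0_integral_cylinder (k := (EFin \o k)^\-)) //; last exact: measurable_funeneg.
rewrite -muleBr //; last first.
  by rewrite fin_num_adde_defr // integrable_fin_num // integrable_funepos.
by rewrite -integralE EFinM !fineK // integrable_fin_num.
Qed.

End Independence.

(** * Approximation by functions of finitely many cylinders *)

Lemma finite_thresholds (R : realType) (M e : R) : 0 < e ->
  exists K (a : 'I_K -> R), forall r r', `|r| <= M -> `|r'| <= M ->
    (forall k, (r <= a k) = (r' <= a k)) -> `|r - r'| <= e.
Proof.
(* The thresholds form a grid of mesh [e] starting at [- M]. With [x = (r + M) / e <= 2 * M / e],
   the first grid point above [r] has index [truncn x + 1], hence the [.+2]; it is at most [r + e],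
   so it would separate [r] from any [r' > r + e]. *)
move=> e0; pose K := (Num.truncn (2 * M / e)).+2.
exists K, (fun k => - M + k%:R * e) => r r'.
wlog rr' : r r' / r <= r'.
  move=> W rM rM' H; have [|/ltW] := leP r r'; first by move/W; apply.
  by rewrite distrC => /W; apply.
move=> /ler_normlP[rM _] /ler_normlP[_ rM'] H.
rewrite distrC ger0_norm ?subr_ge0 // leNgt; apply/negP => er.
pose x := (r + M) / e.
have x0 : 0 <= x by rewrite divr_ge0 ?(ltW e0) //; lra.
have /andP[kx xk] := truncn_itv x0.
have kK : ((Num.truncn x).+1 < K)%N.
  rewrite ltnS ltnS le_truncn // ler_pM2r ?invr_gt0 //; lra.
have xE : r = - M + x * e by rewrite /x divfK ?gt_eqF //; lra.
have := H (Ordinal kK) => /=.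
have -> : r <= - M + (Num.truncn x).+1%:R * e.
  by rewrite {1}xE lerD2l ler_pM2r // ltW.
move=> /esym; rewrite -natr1 mulrDl mul1r => r'k.
have : (Num.truncn x)%:R * e <= x * e by rewrite ler_pM2r.
lra.
Qed.

Lemma subr_split3 (V : zmodType) (a b c e : V) :
  a - e = (a - b) + (b - c) + (c - e).
Proof. by rewrite !addrA !subrK. Qed.

Section FiniteDifference.
Context {R : realType} {n : nat}.
Implicit Types (f : 'rV[R]_n -> R) (q : 'rV[R]_n).

Lemma coordB (u v : 'rV[R]_n) c : (u - v) ord0 c = u ord0 c - v ord0 c.
Proof. by rewrite !mxE. Qed.

Lemma dot_delta (u : 'rV[R]_n) c : dot u (delta_mx ord0 c) = u ord0 c.
Proof.
rewrite /dot (bigD1 c) //= big1 ?addr0 ?mxE ?eqxx ?mulr1 // => i ic.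
by rewrite mxE (negbTE ic) andbF mulr0.
Qed.

Lemma enorm_delta c : enorm (delta_mx ord0 c : 'rV[R]_n) = 1.
Proof.
by apply/eqP; rewrite -sqrp_eq1 ?enorm_ge0 // sqr_enorm dot_delta mxE !eqxx.
Qed.

Lemma fdiff_arith (e K D g g' a b : R) : 0 < e -> a + e * g <= b -> b - e * g' <= a ->
  g' - g <= K -> D * e = b - a -> `|D - g| <= K.
Proof.
move=> e0 h1 h2 h3 DE.
have h4 : g <= D by rewrite -(ler_pM2r e0) DE; lra.
have h5 : D <= g' by rewrite -(ler_pM2r e0) DE; lra.
by rewrite ger0_norm ?subr_ge0 //; lra.
Qed.

Lemma dist_le_approx (D D' g g' a b : R) : `|D - g| <= a -> `|D' - g'| <= a ->
  `|D - D'| <= b -> `|g - g'| <= 2 * a + b.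
Proof. by rewrite !ler_norml; lra. Qed.

Definition fdiff f (e : R) q c := (f (q + e *: delta_mx ord0 c) - f q) / e.

(** By convexity the quotient lies between the partial derivatives at the two endpoints, which
    differ by at most [H * e]. *)
Lemma fdiff_grad f (H e : R) q c : convex_fun f -> (forall u, differentiable f u) ->
  (forall u v, enorm (grad f u - grad f v) <= H * enorm (u - v)) -> 0 < e ->
  `|fdiff f e q c - grad f q ord0 c| <= H * e.
Proof.
move=> cf df lf e0; set q' := q + e *: delta_mx ord0 c.
have q'q : q' - q = e *: delta_mx ord0 c by rewrite /q' addrAC subrr add0r.
have := convex_fun_grad q' cf (df q); rewrite q'q dotZr dot_delta => h1.
have := convex_fun_grad q cf (df q'); rewrite -opprB q'q dotNr dotZr dot_delta => h2.
have := le_trans (enorm_coord _ c) (lf q' q).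
rewrite q'q enormZ enorm_delta mulr1 (gtr0_norm e0) coordB => h3.
have {}h3 := le_trans (ler_norm _) h3.
have fE : fdiff f e q c * e = f q' - f q by rewrite /fdiff divfK // gt_eqF.
exact: (fdiff_arith e0 h1 h2 h3 fE).
Qed.

End FiniteDifference.

Section CylinderApprox.
Context {d d' : measure_display} {Omega : measurableType d} {S : measurableType d'}.
Context {R : realType} {n : nat}.
Variables (xi : nat -> Omega -> S) (G : set Omega) (t : nat).
Implicit Types (y z : Omega -> 'rV[R]_n).

(* Plays the role of "[y] is measurable with respect to [xi_0, ..., xi_(t-1)]";
   bounding the oscillation on each cell avoids choosing values for the approximation. *)
Definition cyl_approx y : Prop := forall e : R, 0 < e ->
  exists (I : finType) (kappa : Omega -> I),
    (forall i, cylinder xi t (kappa @^-1` [set i])) /\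
    (forall w w', G w -> G w' -> kappa w = kappa w' -> enorm (y w - y w') <= e).

Lemma cyl_approx_cst (v : 'rV[R]_n) : cyl_approx (fun=> v).
Proof.
move=> e e0; exists unit, (fun=> tt); split=> [[]|w w' _ _ _].
  by rewrite (_ : _ @^-1` _ = setT) //; [exact: cylinder_setT|apply/seteqP].
by rewrite subrr enorm0 ltW.
Qed.

(** Intersecting the cells of two partitions, of oscillation [e / 2] and [e / (2 * C)], gives one
    that works for [z]. A projected step has this form, with [C] the step size. *)
Lemma cyl_approx_lip (C : R) z y1 y2 : 0 < C -> cyl_approx y1 -> cyl_approx y2 ->
  (forall w w', enorm (z w - z w') <=
    enorm (y1 w - y1 w') + C * enorm (y2 w - y2 w')) ->
  cyl_approx z.
Proof.
move=> C0 a1 a2 zle e e0.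
have [|I1 [k1 [c1 h1]]] := a1 (e / 2); first by rewrite divr_gt0.
have [|I2 [k2 [c2 h2]]] := a2 (e / (2 * C)); first by rewrite divr_gt0 ?mulr_gt0.
exists (I1 * I2)%type, (fun w => (k1 w, k2 w)); split=> [[i1 i2]|w w' Gw Gw' [e1 e2]].
  rewrite (_ : _ @^-1` _ = k1 @^-1` [set i1] `&` k2 @^-1` [set i2]).
    exact: cylinderI.
  by apply/seteqP; split => w /= [-> ->].
apply: le_trans (zle w w') _.
have {}h1 := h1 _ _ Gw Gw' e1; have {}h2 := h2 _ _ Gw Gw' e2.
rewrite -(ler_pM2l C0) in h2.
have CE : C * (e / (2 * C)) = e / 2 by field; rewrite gt_eqF.
by rewrite CE in h2; lra.
Qed.

(** A cell meeting [G] receives the value of [y] at one of its points in [G], hence a point of [X];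
    any other cell receives [x0]. *)
Lemma cyl_approxP (X : set 'rV[R]_n) y (x0 : 'rV[R]_n) : cyl_approx y -> X x0 ->
  (forall w, X (y w)) -> forall e : R, 0 < e ->
  exists (I : finType) (kappa : Omega -> I) (q : I -> 'rV[R]_n),
    [/\ forall i, cylinder xi t (kappa @^-1` [set i]), forall i, X (q i) &
        forall w, G w -> enorm (y w - q (kappa w)) <= e].
Proof.
move=> ya Xx0 Xy e e0; have [I [k [ck hk]]] := ya e e0.
have qP i : exists q, X q /\ forall w, G w -> k w = i -> enorm (y w - q) <= e.
  have [[w' [Gw' kw']]|no] := pselect (exists w, G w /\ k w = i).
    by exists (y w'); split => // w Gw kw; apply: hk => //; rewrite kw.
  by exists x0; split => // w Gw kw; case: no; exists w.
have [q qh] := choice qP.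
by exists I, k, q; split => // [i|w Gw]; [case: (qh i)|case: (qh (k w)) => _; apply].
Qed.

Variables (f : S -> 'rV[R]_n -> R) (GS : set S) (X : set 'rV[R]_n) (L H : R).
Hypothesis H0 : 0 < H.
Hypothesis GE : forall w i, G w -> GS (xi i w).
Hypothesis mf : forall u, measurable_fun setT (fun s => f s u).
Hypothesis fcvx : forall s, GS s -> convex_fun (f s).
Hypothesis fdif : forall s, GS s -> forall u, differentiable (f s) u.
Hypothesis fbd : forall s, GS s -> forall u, X u -> enorm (grad (f s) u) <= L.
Hypothesis flip : forall s, GS s -> forall u v,
  enorm (grad (f s) u - grad (f s) v) <= H * enorm (u - v).

Lemma measurable_fdiff (e : R) q c : measurable_fun setT (fun s => fdiff (f s) e q c).
Proof.
apply: measurable_funM => //; apply: measurable_funB; exact: mf.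
Qed.

(* The gradient is replaced by finite differences, uniformly close to it because it is
   [H]-Lipschitz, and measurable in [s]; these are then binned by finitely many thresholds. *)
Lemma cyl_approx_grad y (x0 : 'rV[R]_n) i : cyl_approx y -> X x0 -> (forall w, X (y w)) ->
  (i < t)%N -> cyl_approx (fun w => grad (f (xi i w)) (y w)).
Proof.
(* Error budget: [e / 4] on each side for moving [y] to the common cell value, [e / 2] for comparing
   the two gradients there. *)
move=> ya Xx0 Xy it e e0; have eE : e / 4 + e / 2 + e / 4 = e by field.
have e1 : 0 < e / (4 * H) by rewrite divr_gt0 ?mulr_gt0.
have [I [k [q [ck Xq kq]]]] := cyl_approxP ya Xx0 Xy e1.
have n0 : 0 < n.+1%:R :> R by [].
(* With [de] and [e2], each coordinate costs [2 * (H * de) + e2 = e / (2 * (n+1))], so all [n]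
   together cost at most [e / 2]; [n.+1] keeps the quotients meaningful when [n = 0]. *)
pose de := e / (8 * H * n.+1%:R); have de0 : 0 < de by rewrite divr_gt0 ?mulr_gt0.
pose e2 := e / (4 * n.+1%:R); have e20 : 0 < e2 by rewrite divr_gt0 ?mulr_gt0.
have [K [a ha]] := finite_thresholds (L + H * de) e20.
pose J : finType := {ffun 'I_n * 'I_K -> bool}.
pose code (j : I) (s : S) : J := [ffun ck => fdiff (f s) de (q j) ck.1 <= a ck.2].
exists (I * J)%type, (fun w => (k w, code (k w) (xi i w))); split.
  move=> [j b].
  rewrite (_ : _ @^-1` _ = k @^-1` [set j] `&` xi i @^-1` [set s | code j s = b]).
    apply: cylinderI => //; apply: cylinder_preimage => //.
    rewrite (_ : [set s | _] =
      \bigcap_(ck in [set: 'I_n * 'I_K])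
        [set s | (fdiff (f s) de (q j) ck.1 <= a ck.2) = b ck]).
      apply: fin_bigcap_measurable => // -[c m] _ /=.
      have mle : measurable [set s | fdiff (f s) de (q j) c <= a m].
        have := measurable_fdiff de (q j) c measurableT (measurable_itv `]-oo, a m]).
        by rewrite setTI; congr measurable; apply/seteqP; split => s /=; rewrite in_itv.
      case: (b _) => //.
      rewrite (_ : [set s | _] = ~` [set s | fdiff (f s) de (q j) c <= a m]).
        exact: measurableC.
      by apply/seteqP; split => s /=; [move=> ->|move/negP/negbTE].
    apply/seteqP; split => s /=; first by move=> <- cm _ /=; rewrite ffunE.
    by move=> H1; apply/ffunP => cm; rewrite ffunE; exact: H1.
  by apply/seteqP; split => w /= [-> ->].
move=> w w' Gw Gw' [kk]; rewrite -kk => /ffunP codeE.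
set s := xi i w in codeE *; set s' := xi i w' in codeE *.
have Gs : GS s by exact: GE. have Gs' : GS s' by exact: GE.
set u := q (k w) in codeE.
have Xu : X u by exact: Xq.
have b1 : enorm (grad (f s) (y w) - grad (f s) u) <= e / 4.
  apply: le_trans (flip Gs _ _) _.
  have -> : e / 4 = H * (e / (4 * H)) by field; rewrite gt_eqF.
  by rewrite ler_pM2l //; exact: kq.
have b2 : enorm (grad (f s') (y w') - grad (f s') u) <= e / 4.
  apply: le_trans (flip Gs' _ _) _.
  have -> : e / 4 = H * (e / (4 * H)) by field; rewrite gt_eqF.
  by rewrite ler_pM2l // /u kk; exact: kq.
have cb r c : GS r -> `|fdiff (f r) de u c| <= L + H * de.
  move=> Gr; have h1 := fdiff_grad u c (fcvx Gr) (fdif Gr) (flip Gr) de0.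
  have h2 := le_trans (enorm_coord _ c) (fbd Gr Xu).
  rewrite -[fdiff _ _ _ _](subrK (grad (f r) u ord0 c)) addrC.
  by apply: le_trans (ler_normD _ _) _; rewrite lerD.
have b3 : enorm (grad (f s) u - grad (f s') u) <= e / 2.
  apply: le_trans (enorm_le_sum _) _.
  apply: (@le_trans _ _ (\sum_(c < n) (2 * (H * de) + e2))).
    apply: ler_sum => c _; rewrite coordB.
    have h1 := fdiff_grad u c (fcvx Gs) (fdif Gs) (flip Gs) de0.
    have h2 := fdiff_grad u c (fcvx Gs') (fdif Gs') (flip Gs') de0.
    have h3 : `|fdiff (f s) de u c - fdiff (f s') de u c| <= e2.
      apply: ha; [exact: cb|exact: cb|move=> m].
      by have := codeE (c, m); rewrite !ffunE.
    exact: (dist_le_approx h1 h2 h3).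
  rewrite sumr_const card_ord -[leLHS]mulr_natr.
  apply: (@le_trans _ _ ((2 * (H * de) + e2) * n.+1%:R)).
    apply: ler_wpM2l; last by rewrite ler_nat.
    by rewrite ltW // addr_gt0 // mulr_gt0 // mulr_gt0.
  rewrite le_eqVlt; apply/orP; left; apply/eqP; rewrite /de /e2.
  by field; rewrite nat1r !gt_eqF.
rewrite (subr_split3 _ (grad (f s) u) (grad (f s') u)).
rewrite enormB in b2; apply: le_trans (enormD _ _) _.
rewrite -[leRHS]eE.
exact: lerD (le_trans (enormD _ _) (lerD b1 b3)) b2.
Qed.

End CylinderApprox.

(** * Decoupling *)

Lemma sum_nat_shift (V : zmodType) (a : nat -> V) (m k : nat) :
  \sum_(1 <= t < (m + k).+1) a t =
  \sum_(1 <= t < m.+1) a t + \sum_(1 <= i < k.+1) a (i + m)%N.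
Proof.
rewrite (@big_cat_nat _ _ _ m.+1) //=; last by rewrite ltnS leq_addr.
by congr (_ + _); rewrite -[m.+1]add1n big_addn -addnS addKn.
Qed.

(** Splitting the sum up to [T + tau] either at [T] or at [tau] exchanges the roles of the two
    numbers, leaving [tau] differences [a i - a (i + T)], whichever is larger. *)
Lemma sum_delay_le (R : realType) (a : nat -> R) (c : R) (T tau : nat) :
  (forall i j, (1 <= i <= T + tau)%N -> (1 <= j <= T + tau)%N -> a i - a j <= c) ->
  \sum_(1 <= t < T.+1) (a t - a (t + tau)%N) <= tau%:R * c.
Proof.
move=> ac.
have -> : \sum_(1 <= t < T.+1) (a t - a (t + tau)%N) =
    \sum_(1 <= i < tau.+1) (a i - a (i + T)%N).
  rewrite !sumrB; have := sum_nat_shift a T tau; rewrite addnC sum_nat_shift => E.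
  by lra.
apply: (@le_trans _ _ (\sum_(1 <= i < tau.+1) c)).
  by apply: ler_sum_nat => i itau; apply: ac; lia.
by rewrite sumr_const_nat subSS subn0 mulr_natl.
Qed.

Lemma has_mean_le {d} {Omega : measurableType d} (R : realType) (P : probability Omega R)
  (Y1 Y2 : Omega -> R) (m1 m2 : R) (N : set Omega) :
  measurable N -> P N = 0%E -> has_mean P Y1 m1 -> has_mean P Y2 m2 ->
  (forall w, ~ N w -> Y1 w <= Y2 w) -> m1 <= m2.
Proof.
move=> mN N0 [i1 e1] [i2 e2] Y12; rewrite -lee_fin -e1 -e2.
apply: (le_integral_negligible mN N0) => //.
exact/measurable_EFinP/(measurable_int P).
Qed.

Section Decoupling.
Context {d d' : measure_display} {Omega : measurableType d} {S : measurableType d'}.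
Context {R : realType} {n : nat} (P : probability Omega R) (p : probability S R).
Variables (xi : nat -> Omega -> S) (f : S -> 'rV[R]_n -> R).
Variables (N : set S) (X : set 'rV[R]_n) (L : R).
Hypothesis mxi : forall t, measurable_fun setT (xi t).
Hypothesis indep : mutually_independent P xi.
Hypothesis idist : identically_distributed P p xi.
Hypothesis mN : measurable N.
Hypothesis N0 : p N = 0%E.
Hypothesis X0 : X 0.
Hypothesis L0 : 0 < L.
Hypothesis intf : forall q, X q -> p.-integrable setT (fun s => (f s q)%:E).
Hypothesis lipf : forall s, ~ N s -> forall u v, X u -> X v ->
  f s u - f s v <= L * enorm (u - v).

Let G := [set w | forall i, ~ N (xi i w)].
Let risk q := \int[p]_s f s q.

Lemma negligible_bad : measurable (~` G) /\ P (~` G) = 0%E.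
Proof.
have mX i : measurable (xi i @^-1` N) by exact: measurable_xi.
have E : ~` G = \bigcup_i (xi i @^-1` N).
  apply/seteqP; split => w /=; first by move=> /existsNP[i /contrapT ?]; exists i.
  by move=> [i _ Ni] /(_ i).
have mG : measurable (~` G) by rewrite E; exact: bigcup_measurable.
split=> //; apply/negligibleP => //; rewrite E; apply: negligible_bigcup => i.
by apply/negligibleP => //; exact: etrans (idist i mN) N0.
Qed.

Lemma has_mean_risk q : X q -> has_mean p (fun s => f s q) (risk q).
Proof.
by move=> Xq; split; [exact: intf|rewrite fineK // integrable_fin_num // intf].
Qed.

Lemma risk_lip u v : X u -> X v -> risk u - risk v <= L * enorm (u - v).
Proof.
move=> Xu Xv; rewrite lerBlDl.
apply: (has_mean_le mN N0 (has_mean_risk Xu)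
  (has_meanD (has_mean_risk Xv) (has_mean_cst p (L * enorm (u - v))))) => s /= Ns.
by rewrite -lerBlDl lipf.
Qed.

(** Replace [y] by its cell value [q i]. On each cell [xi t] is independent of the past, so
    [f (xi t w) (q i)] and [risk (q i)] have the same mean over the cell; [Y] and [Z] are the
    resulting integrable stand-ins with a common mean. *)
Lemma decouple t y (e : R) : cyl_approx xi G t y -> (forall w, X (y w)) -> 0 < e ->
  exists (Y Z : Omega -> R) (m : R), [/\ has_mean P Y m, has_mean P Z m,
    forall w, G w -> `|f (xi t w) (y w) - Y w| <= L * e &
    forall w, G w -> `|Z w - risk (y w)| <= L * e].
Proof.
move=> ya Xy e0; have [I [k [q [ck Xq kq]]]] := cyl_approxP ya X0 Xy e0.
pose A i := k @^-1` [set i].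
pose sel (h : I -> Omega -> R) w := \sum_i \1_(A i) w * h i w.
have selE h w : sel h w = h (k w) w.
  rewrite /sel (bigD1 (k w)) //= big1 ?addr0 => [|i ik].
    by rewrite indicE mem_set // mul1r.
  by rewrite indicE memNset ?mul0r // => /= ki; rewrite ki eqxx in ik.
exists (sel (fun i w => f (xi t w) (q i))), (sel (fun i _ => risk (q i))).
exists (\sum_i fine (P (A i)) * risk (q i)); split.
- apply: has_mean_sum => i.
  exact: (has_mean_cylinder mxi indep idist (ck i) (intf (Xq i))).
- apply: has_mean_sum => i.
  have [ic ec] := has_mean_cst p (risk (q i)).
  by have := has_mean_cylinder mxi indep idist (ck i) ic; rewrite /Rintegral ec.
- move=> w Gw; rewrite selE; have := kq w Gw; rewrite -(ler_pM2l L0) => le.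
  rewrite ler_norml; apply/andP; split.
    by rewrite lerNl opprB (le_trans _ le) // enormB lipf.
  by rewrite (le_trans _ le) // lipf.
- move=> w Gw; rewrite selE; have := kq w Gw; rewrite -(ler_pM2l L0) => le.
  rewrite ler_norml; apply/andP; split.
    by rewrite lerNl opprB (le_trans _ le) // risk_lip.
  by rewrite (le_trans _ le) // enormB risk_lip.
Qed.

Lemma decouple_sum (x : nat -> Omega -> 'rV[R]_n) (e : R) (tau T : nat) : 0 < e ->
  (forall t, (1 <= t <= T)%N ->
    cyl_approx xi G t (x t) /\ cyl_approx xi G t (x (t + tau)%N)) ->
  (forall t w, (1 <= t <= T + tau)%N -> X (x t w)) ->
  exists (Y Z : Omega -> R) (m : R), [/\ has_mean P Y m, has_mean P Z m,
    forall w, G w ->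
      \sum_(1 <= t < T.+1) (f (xi t w) (x t w) - f (xi t w) (x (t + tau)%N w)) <=
        Y w + T%:R * (2 * L * e) &
    forall w, G w ->
      Z w <= \sum_(1 <= t < T.+1) (risk (x t w) - risk (x (t + tau)%N w))
        + T%:R * (2 * L * e)].
Proof.
move=> e0; elim: T => [_ _|T IH xa Xx].
  exists (cst 0), (cst 0), 0; split; try exact: has_mean_cst.
    by move=> w _; rewrite big_geq // mul0r addr0.
  by move=> w _; rewrite big_geq // mul0r addr0.
have [||Y [Z [m [hY hZ YP ZP]]]] := IH.
- by move=> t tT; apply: xa; lia.
- by move=> t w tT; apply: Xx; lia.
have [|a1 a2] := xa T.+1; first by rewrite leqnn.
have [|Y1 [Z1 [m1 [hY1 hZ1 Y1P Z1P]]]] := decouple a1 _ e0.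
  by move=> w; apply: Xx; lia.
have [|Y2 [Z2 [m2 [hY2 hZ2 Y2P Z2P]]]] := decouple a2 _ e0.
  by move=> w; apply: Xx; lia.
exists (fun w => Y w + (Y1 w + - Y2 w)), (fun w => Z w + (Z1 w + - Z2 w)).
exists (m + (m1 + - m2)); split.
- by apply: has_meanD => //; apply: has_meanD => //; exact: has_meanN.
- by apply: has_meanD => //; apply: has_meanD => //; exact: has_meanN.
- move=> w Gw; rewrite big_nat_recr //= -natr1.
  by move: (YP w Gw) (Y1P w Gw) (Y2P w Gw); rewrite !ler_norml; lra.
- move=> w Gw; rewrite big_nat_recr //= -natr1.
  by move: (ZP w Gw) (Z1P w Gw) (Z2P w Gw); rewrite !ler_norml; lra.
Qed.

End Decoupling.

(** * Numerical constants of the final bound *)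

Lemma delay_rate_le (R : rcfType) (F L H t : R) : 0 < F -> 0 < L -> 0 < H -> 1 <= t ->
  L / (4 * F * Num.sqrt t) <= H -> F * L * t <= 4 * F ^+ 2 * H * t ^+ 2.
Proof.
move=> F0 L0 H0 t1; have s0 : 0 < Num.sqrt t by rewrite sqrtr_gt0 (lt_le_trans ltr01).
rewrite ler_pdivrMr ?mulr_gt0 // => LH.
have st : Num.sqrt t <= t.
  rewrite -[leRHS]sqr_sqrtr ?(le_trans ler01) // expr2 ler_peMr ?(ltW s0) //.
  by rewrite -sqrtr1 ler_sqrt // (le_trans ler01).
have {}LH : L <= H * (4 * F * t).
  by apply: le_trans LH _; rewrite ler_pM2l // ler_pM2l ?mulr_gt0.
have Ft : 0 < F * t by rewrite mulr_gt0 // (lt_le_trans ltr01).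
by rewrite -(ler_pM2l Ft) in LH; lra.
Qed.

(** The [F L t] terms add up to [3/2 + 1/4 + 1/4 = 2], hence at most [8 F^2 H t^2]; the drift adds
    [2 + 1], for a total of [11 <= 28.3]. The logarithm and the square root have coefficients
    [1 <= 4/3] and [2 <= 8/3]. *)
Lemma final_bound_le (R : realFieldType) (F L H t l s m : R) :
  0 < F -> 0 < L -> 0 < H -> 1 <= t -> 0 <= l -> 0 <= s ->
  m <= t * (L * (3 / 2 * F)) + F * L * t / 4 ->
  F * L * t <= 4 * F ^+ 2 * H * t ^+ 2 ->
  m + (2 * F * L * s + H * (2 * F ^+ 2 * t + (F * t) ^+ 2 * (1 + l)) + F * L * t / 4) <=
    (283 / 10 * F ^+ 2 * H + 2 / 3 * F * L + 4 / 3 * F ^+ 2 * H * l) * t ^+ 2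
      + 8 / 3 * F * L * s.
Proof.
move=> F0 L0 H0 t1 l0 s0 hm hL.
have FL0 : 0 <= F * L by rewrite mulr_ge0 ?ltW.
have FH0 : 0 <= F ^+ 2 * H by rewrite mulr_ge0 ?sqr_ge0 ?ltW.
have FLs : 0 <= F * L * s by rewrite mulr_ge0.
have FLt : 0 <= F * L * t ^+ 2 by rewrite mulr_ge0 ?sqr_ge0.
have FHt : 0 <= F ^+ 2 * H * t ^+ 2 by rewrite mulr_ge0 ?sqr_ge0.
have FHtl : 0 <= F ^+ 2 * H * t ^+ 2 * l by rewrite mulr_ge0.
have tt : F ^+ 2 * H * t <= F ^+ 2 * H * t ^+ 2.
  by rewrite ler_wpM2l // expr2 ler_peMr // (le_trans ler01).
lra.
Qed.

(** * The iterates as functions of the past *)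

Section Iterates.
Context {d d' : measure_display} {Omega : measurableType d} {S : measurableType d'}.
Context {R : realType} {n : nat}.
Variables (X : set 'rV[R]_n) (F L H : R) (tau T : nat) (N : set S).
Variables (f : S -> 'rV[R]_n -> R) (xi : nat -> Omega -> S) (x : nat -> Omega -> 'rV[R]_n).
Hypothesis X0 : X 0.
Hypothesis init : forall t w, (1 <= t <= tau.+1)%N -> x t w = 0.
Hypothesis step : forall t w, (tau.+1 <= t <= T + tau)%N ->
  is_proj X (x t w - ((F / L) / Num.sqrt ((t - tau)%:R)) *:
      grad (f (xi (t - tau)%N w)) (x (t - tau)%N w)) (x t.+1 w).

Lemma iterate_in t w : (1 <= t <= (T + tau).+1)%N -> X (x t w).
Proof.
move=> tT; have [ttau|] := leqP t tau.+1; first by rewrite init ?X0 //; lia.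
case: t tT => [//|t] tT ttau; have [] // := @step t w; lia.
Qed.

Hypothesis cX : convex_set X.
Hypothesis F0 : 0 < F.
Hypothesis L0 : 0 < L.
Hypothesis H0 : 0 < H.
Hypothesis mf : forall y, measurable_fun setT (fun s => f s y).
Hypothesis fcvx : forall s, ~ N s -> convex_fun (f s).
Hypothesis fdif : forall s, ~ N s -> forall u, differentiable (f s) u.
Hypothesis fbd : forall s, ~ N s -> forall u, X u -> enorm (grad (f s) u) <= L.
Hypothesis flip : forall s, ~ N s -> forall u v,
  enorm (grad (f s) u - grad (f s) v) <= H * enorm (u - v).

Let G := [set w | forall i, ~ N (xi i w)].

(** Strong induction on [u]. The update producing [x v.+1] uses [xi (v - tau)], and
    [v.+1 <= t + tau] puts that index strictly below [t]: the delay is what lets [x (t + tau)]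
    depend only on the past of [t]. *)
Lemma iterate_approx u t : (1 <= u <= (T + tau).+1)%N -> (u <= t + tau)%N ->
  cyl_approx xi G t (x u).
Proof.
elim/ltn_ind: u => u IH uT ut; have [utau|] := leqP u tau.+1.
  rewrite (_ : x u = fun=> 0); first exact: cyl_approx_cst.
  by apply/funext => w; rewrite init //; lia.
case: u IH uT ut => [//|v] IH vT vt tauv.
have a1 : cyl_approx xi G t (x v) by apply: IH; lia.
have a2 : cyl_approx xi G t (fun w => grad (f (xi (v - tau)%N w)) (x (v - tau)%N w)).
  apply: (cyl_approx_grad (GS := ~` N) H0 _ mf fcvx fdif fbd flip _ X0) => //; try lia.
  - by move=> w i; apply.
  - by apply: IH; lia.
  - by move=> w; apply: iterate_in; lia.
have C0 : 0 < F / L / Num.sqrt ((v - tau)%:R : R).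
  by rewrite !divr_gt0 // sqrtr_gt0 ltr0n; lia.
apply: (cyl_approx_lip C0 a1 a2) => w w'.
have vv : (tau.+1 <= v <= T + tau)%N by lia.
apply: le_trans (is_proj_nonexp cX (step w vv) (step w' vv)) _.
have subE (a b g g' : 'rV[R]_n) (c : R) :
    a - c *: g - (b - c *: g') = (a - b) - c *: (g - g').
  by apply/rowP => i; rewrite !mxE; ring.
by rewrite subE; apply: le_trans (enormD _ _) _; rewrite enormN enormZ (gtr0_norm C0).
Qed.

End Iterates.
Unset Implicit Arguments.

Theorem theorem8
  (R : realType) (n : nat)
  (X : set 'rV[R]_n)
  (F L H : R) (tau T : nat)
  (d d' : measure_display) (Omega : measurableType d) (S : measurableType d')
  (P : probability Omega R) (p : probability S R)
  (f : S -> 'rV[R]_n -> R)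
  (xi : nat -> Omega -> S)
  (xstar : 'rV[R]_n)
  (x : nat -> Omega -> 'rV[R]_n) :
  (* the feasible set *)
  X !=set0 -> closed X -> convex_set X -> X 0 ->
  (* diameter bound: max_{x,x' in X} D(x||x') <= F^2 *)
  (forall y y', X y -> X y' -> enorm (y - y') ^+ 2 / 2 <= F ^+ 2) ->
  0 < F -> 0 < L ->
  (1 <= tau)%N ->
  L / (4 * F * Num.sqrt (tau%:R)) <= H ->
  (* the distribution p of random functions f(s, .) *)
  (forall y, measurable_fun setT (fun s => f s y)) ->
  (forall y, X y -> p.-integrable setT (fun s => (f s y)%:E)) ->
  {ae p, forall s, convex_fun (f s) /\ (forall y, differentiable (f s) y) /\
     (forall y, X y -> enorm (grad (f s) y) <= L) /\
     (forall y y', enorm (grad (f s) y - grad (f s) y') <= H * enorm (y - y'))} ->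
  (* f_1, f_2, ... are i.i.d. with law p *)
  (forall t, measurable_fun setT (xi t)) ->
  mutually_independent P xi ->
  identically_distributed P p xi ->
  (* x* minimizes f^*(x) = E_{f ~ p}[f(x)] over X *)
  X xstar ->
  (forall y, X y -> (\int[p]_s (f s xstar)%:E <= \int[p]_s (f s y)%:E)%E) ->
  (* delayed SGD with eta_t = sigma / sqrt(t - tau), sigma = F / L *)
  (forall t w, (1 <= t <= tau.+1)%N -> x t w = 0) ->
  (forall t w, (tau.+1 <= t <= T + tau)%N ->
     is_proj X
       (x t w - ((F / L) / Num.sqrt ((t - tau)%:R)) *:
                  grad (f (xi (t - tau)%N w)) (x (t - tau)%N w))
       (x t.+1 w)) ->
  ('E_P[fun w => (\sum_(1 <= t < T.+1) (f (xi t w) (x t w) - f (xi t w) xstar))%R]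
    <= ((283 / 10 * F ^+ 2 * H + 2 / 3 * F * L
          + 4 / 3 * F ^+ 2 * H * ln (T%:R)) * tau%:R ^+ 2
        + 8 / 3 * F * L * Num.sqrt (T%:R))%:E)%E.
Proof.
move=> _ _ cX X0 diamX F0 L0 tau1 HL mf intf [N [mN N0 subN]] mxi indep idist Xstar _ init step.
have nice s : ~ N s -> convex_fun (f s) /\ (forall y, differentiable (f s) y) /\
     (forall y, X y -> enorm (grad (f s) y) <= L) /\
     (forall y y', enorm (grad (f s) y - grad (f s) y') <= H * enorm (y - y')).
  by move=> Ns; apply: contrapT => /subN.
have fcvx s Ns := (nice s Ns).1.
have fdif s Ns := (nice s Ns).2.1.
have fbd s Ns := (nice s Ns).2.2.1.
have flip s Ns := (nice s Ns).2.2.2.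
have stau : 0 < Num.sqrt (tau%:R : R) by rewrite sqrtr_gt0 ltr0n.
have H0 : 0 < H by apply: lt_le_trans HL; rewrite divr_gt0 ?mulr_gt0.
have lipf s : ~ N s -> forall u v, X u -> X v -> f s u - f s v <= L * enorm (u - v).
  move=> Ns u v Xu Xv; have := convex_fun_grad v (fcvx _ Ns) (fdif _ Ns u).
  rewrite -(opprB u v) dotNr lerBlDr -lerBlDl => /le_trans; apply.
  apply: le_trans (dot_le _ _) _; rewrite ler_wpM2r ?enorm_ge0 //; exact: fbd.
have Xx := @iterate_in _ _ _ _ _ _ X F L tau T f xi x X0 init step.
pose G := [set w | forall i, ~ N (xi i w)].
have [mG PG] := negligible_bad mxi idist mN N0.
have appr := @iterate_approx _ _ _ _ _ _ X F L H tau T N f xi x X0 init step cX F0 L0 H0 mf fcvx fdif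
  fbd flip.
(* Chosen so that the accumulated approximation error [T * (2 * L * e)] is at most
   [F * L * tau / 4]; [T.+1] avoids a zero denominator. *)
pose e := F * tau%:R / (8 * T.+1%:R).
have tau0 : 0 < tau%:R :> R by rewrite ltr0n.
have e0 : 0 < e by rewrite divr_gt0 ?mulr_gt0.
have [||Y [Z [m [hY hZ YP ZP]]]] := decouple_sum mxi indep idist mN N0 X0 L0 intf lipf
  (x := x) (tau := tau) (T := T) e0.
- by move=> t tT; split; apply: appr; lia.
- by move=> t w tT; apply: Xx; lia.
have Te : T%:R * (2 * L * e) <= F * L * tau%:R / 4.
  have -> : T%:R * (2 * L * e) = F * L * tau%:R / 4 * (T%:R / T.+1%:R).
    by rewrite /e; field; rewrite nat1r gt_eqF.
  have c0 : 0 <= F * L * tau%:R / 4 by rewrite divr_ge0 ?mulr_ge0 ?(ltW F0) ?(ltW L0).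
  by rewrite ler_piMr // ler_pdivrMr // mul1r ler_nat.
pose B := 2 * F * L * Num.sqrt T%:R
    + H * (2 * F ^+ 2 * tau%:R + (F * tau%:R) ^+ 2 * (1 + ln T%:R)).
(* The diameter is at most [sqrt 2 * F], and [2 <= 9/4]. *)
have diam u v : X u -> X v -> enorm (u - v) <= 3 / 2 * F.
  move=> Xu Xv; rewrite -(@ler_pXn2r _ 2) ?nnegrE ?enorm_ge0 ?mulr_ge0 ?(ltW F0) //.
  have := diamX _ _ Xu Xv; have := sqr_ge0 F; rewrite exprMn; lra.
(* The common mean of [Y] and [Z] is estimated through [Z], whose bound is a sum of risk differences
   that telescopes pointwise. *)
have mle : m <= tau%:R * (L * (3 / 2 * F)) + F * L * tau%:R / 4.
  apply: (has_mean_le mG PG hZ (has_mean_cst P _)) => w /contrapT Gw /=.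
  apply: le_trans (ZP w Gw) _; apply: lerD => //; apply: sum_delay_le => i j iT jT.
  have Xi : X (x i w) by apply: Xx; lia.
  have Xj : X (x j w) by apply: Xx; lia.
  apply: le_trans (risk_lip mN N0 intf lipf Xi Xj) _.
  by rewrite ler_pM2l //; exact: diam.
have regret w : G w -> \sum_(1 <= t < T.+1) (f (xi t w) (x t w) - f (xi t w) xstar) <=
    Y w + (B + F * L * tau%:R / 4).
  move=> Gw.
  have := YP w Gw.
  have := @delayed_regret_le R n X F L H tau T (fun t => f (xi t w)) (fun t => x t w) cX F0 L0
    (ltW H0) diamX (fun t => fcvx _ (Gw t)) (fun t => fdif _ (Gw t)) (fun t => fbd _ (Gw t))
    (fun t => flip _ (Gw t)) (fun t => Xx t w) (fun t => step t w) xstar Xstar.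
  rewrite -/B => h1 h2.
  have {Te} := lerD h1 (le_trans h2 (lerD (lexx _) Te)).
  rewrite -big_split /= (eq_bigr (fun t => f (xi t w) (x t w) - f (xi t w) xstar)).
    by move=> h3; apply: le_trans h3 _; rewrite addrCA addrA.
  by move=> t _; rewrite addrC subrKA.
have mean := has_meanD hY (has_mean_cst P (B + F * L * tau%:R / 4)).
(* Off the null set the regret is below [Y] plus a constant, which is integrable with this mean. *)
apply: (@le_trans _ _ (m + (B + F * L * tau%:R / 4))%:E).
  rewrite expectation.unlock -mean.2.
  apply: (le_integral_negligible mG PG).
    exact/measurable_EFinP/(measurable_int P mean.1).
  by move=> w /contrapT Gw; exact: regret.
rewrite lee_fin.
have HL' : F * L * tau%:R <= 4 * F ^+ 2 * H * tau%:R ^+ 2.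
  by apply: (delay_rate_le F0 L0 H0 _ HL); rewrite ler1n.
have tau1R : 1 <= tau%:R :> R by rewrite ler1n.
have lnT : 0 <= ln (T%:R : R).
  by case: (T) => [|T']; [rewrite ln0|rewrite ln_ge0 // ler1n].
exact: (final_bound_le F0 L0 H0 tau1R lnT (sqrtr_ge0 _) mle HL').
Qed.
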